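(* Let $d\in \mathbb{Q}$ with $d\ge 0$. Then the structure $(\mathbb{R},<,+,\mathbb{Z},\mathbb{Z}\sqrt{d})$ defines (without parameters) the function $\lambda_{\sqrt{d}}:\mathbb{R}\to\mathbb{R}$, $x\mapsto \sqrt{d}\,x$.
   Context: $\mathbb{Z}$ and $\mathbb{Z}\sqrt{d}=\{k\sqrt{d}: k\in\mathbb{Z}\}$ are unary predicates. A function is defined by a structure if its graph is first-order definable in it without parameters. *)

(* Defs.v *)
From mathcomp Require Import all_boot all_order all_algebra.
From mathcomp Require Import classical_sets reals.
Set Implicit Arguments.
Unset Strict Implicit.
Unset Printing Implicit Defensive.
Import Order.TTheory GRing.Theory Num.Theory.
Local Open Scope classical_set_scope.
Local Open Scope ring_scope.

Record language := Language {
  func : Type;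
  func_arity : func -> nat;
  pred_sym : Type;
  pred_arity : pred_sym -> nat
}.

Record model (L : language) := Model {
  carrier :> Type;
  func_interp : forall f : func L, ('I_(func_arity f) -> carrier) -> carrier;
  pred_interp : forall p : pred_sym L, ('I_(pred_arity p) -> carrier) -> Prop
}.

Inductive term (L : language) (n : nat) : Type :=
| Tvar of 'I_n
| Tapp (f : func L) of ('I_(func_arity f) -> term L n).

(* [formula L n] is the type of L-formulas whose free variables are among
   n variables.  In [Fall A] (universal quantification) the variable [ord0] of A
   is bound and the variable [lift ord0 i] of A stands for the variable i.
   The other connectives and the existential quantifier are classically derived. *)
Inductive formula (L : language) : nat -> Type :=
| Fbot n : formula L n
| Feq n : term L n -> term L n -> formula L n
| Fpred n (p : pred_sym L) : ('I_(pred_arity p) -> term L n) -> formula L n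
| Fimp n : formula L n -> formula L n -> formula L n
| Fall n : formula L n.+1 -> formula L n.

Definition scons (T : Type) (n : nat) (x : T) (v : 'I_n -> T) : 'I_n.+1 -> T :=
  fun i => oapp v x (unlift ord0 i).

Fixpoint eval (L : language) (M : model L) (n : nat) (v : 'I_n -> M)
    (t : term L n) : M :=
  match t with
  | Tvar i => v i
  | Tapp f a => func_interp (fun j => eval v (a j))
  end.

Fixpoint sat (L : language) (M : model L) (n : nat) (A : formula L n) :
    ('I_n -> M) -> Prop :=
  match A in formula _ n return ('I_n -> M) -> Prop with
  | Fbot _ => fun _ => False
  | Feq _ s t => fun v => eval v s = eval v t
  | Fpred _ p a => fun v => pred_interp (fun j => eval v (a j))
  | Fimp _ B C => fun v => sat B v -> sat C v
  | Fall _ B => fun v => forall x : M, sat B (scons x v)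
  end.

(* The formula has no symbols for elements of the carrier: definability is
   without parameters. *)
Definition definable_set (L : language) (M : model L) (n : nat)
    (X : set ('I_n -> M)) : Prop :=
  exists A : formula L n, forall v : 'I_n -> M, sat A v <-> X v.

Definition definable_fun (L : language) (M : model L) (f : M -> M) : Prop :=
  definable_set [set v : 'I_2 -> M | v ord_max = f (v ord0)].

Variant group_func : Type := Plus.
Variant group_pred : Type := Less | InZ | InZsqrt.

Definition lang_two_groups : language := {|
  func := group_func;
  func_arity := fun _ => 2%N;
  pred_sym := group_pred;
  pred_arity := fun p => match p with Less => 2%N | InZ | InZsqrt => 1%N end
|}.

(* The structure (R, <, +, Z, Z sqrt(d)). *)
Definition real_two_groups (R : realType) (d : rat) : model lang_two_groups :=
  @Model lang_two_groups R
    (fun _ (v : 'I_2 -> R) => v ord0 + v ord_max)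
    (fun p : group_pred =>
       match p return ('I_(@pred_arity lang_two_groups p) -> R) -> Prop with
       | Less => fun v : 'I_2 -> R => v ord0 < v ord_max
       | InZ => fun v : 'I_1 -> R => exists k : int, v ord0 = k%:~R
       | InZsqrt => fun v : 'I_1 -> R =>
           exists k : int, v ord0 = k%:~R * Num.sqrt (ratr d)
       end).

(* Main.v *)
(* Write d = A / b, N = A b and al = b sqrt d = sqrt N.  It suffices to define
   multiplication by al from Z and Z al.  If N is a square, al is an integer.
   Otherwise elements n + m al of the lattice L = Z + Z al are handled as pairs
   (n, m al), on which the conjugation z |-> z' = n - m al is definable.

   The pairs (u, al u), with u a totally positive unit of norm 1, are definable:
   al u is the unique lattice point v such that v / u and - v' / u' lie strictly
   between a = floor al and a + 1, and u is a unit iff all lattice points in a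
   fixed multiple of the box |z| <= u, |z'| <= u' are combinations of u and al u
   with coefficients bounded by a constant.

   For x >= 0 let s_u(x) be the greatest z in L with z <= x and
   |z'| <= (a + 2) u', and let t_u(y) be its analogue for the lattice al L, so
   that t_u(al x) = al s_u(x).  If w >= 2 u is the product of u with a fixed unit
   (obtained from Pell's equation), then s_u(x) - s_w(x) is one of finitely many
   combinations n u + m al u, and y = al x can be tested on every unit u by
   comparing it with t_u(y) - t_w(y) = n al u + m N u.  Conversely s_u(x) and
   t_u(y) vanish for u large and tend to x and y as u tends to 0, so these local
   conditions force y = al x. *)
Require Import Defs.
From mathcomp Require Import all_boot all_order all_algebra.
From mathcomp Require Import boolp classical_sets reals.
From mathcomp Require Import ring lra zify.
Set Implicit Arguments.
Unset Strict Implicit.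
Unset Printing Implicit Defensive.
Import Order.TTheory GRing.Theory Num.Theory.
Local Open Scope ring_scope.

(** * Closure properties of definable sets *)

Section Definability.
Context {R : realType} {d : rat}.
Local Notation M := (real_two_groups R d).
Local Notation LL := lang_two_groups.

(* Variables are de Bruijn indices into an infinite environment, so that under a
   binder the variables of a concrete predicate remain of the form [e k]. *)
Definition dfn n (P : (nat -> R) -> Prop) :=
  exists A : formula LL n, forall e : nat -> R,
    sat (M := M) A (fun i : 'I_n => e i) <-> P e.

(* The language has no subtraction: a term with integer coefficients is coded as
   a difference, so that comparisons only need to move summands across. *)
Definition dterm n (f : (nat -> R) -> R) :=
  exists s t : term LL n, forall e : nat -> R,
    f e = eval (M := M) (fun i : 'I_n => e i) s -
          eval (M := M) (fun i : 'I_n => e i) t.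

Definition tadd n (s t : term LL n) : term LL n :=
  Tapp (f := Plus : func LL) (fun i : 'I_2 => if i == ord0 then s else t).

Lemma eval_tadd n (v : 'I_n -> R) s t :
  eval (M := M) v (tadd s t) = eval (M := M) v s + eval (M := M) v t :> R.
Proof. by []. Qed.

Lemma dterm_var n k : (k < n)%N -> dterm n (fun e => e k).
Proof.
move=> kn; pose t := Tvar LL (Ordinal kn); exists (tadd t t), t.
by move=> e; rewrite eval_tadd /= addrK.
Qed.

Lemma dtermD n f g : dterm n f -> dterm n g -> dterm n (fun e => f e + g e).
Proof.
move=> [s [t fE]] [s' [t' gE]]; exists (tadd s s'), (tadd t t') => e.
by rewrite !eval_tadd fE gE opprD addrACA.
Qed.

Lemma dtermN n f : dterm n f -> dterm n (fun e => - f e).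
Proof. by move=> [s [t fE]]; exists t, s => e; rewrite fE opprB. Qed.

(** The language has no constant symbols, so zero is coded as [x - x]; this is why at least one
    variable must be present. *)
Lemma dterm0 n : dterm n.+1 (fun=> 0).
Proof. by exists (Tvar LL ord0), (Tvar LL ord0) => e; rewrite subrr. Qed.

Lemma dtermMn n f c : dterm n.+1 f -> dterm n.+1 (fun e => c%:R * f e).
Proof.
move=> df; elim: c => [|c [s [t IH]]].
  by have [s [t sE]] := dterm0 n; exists s, t => e; rewrite mul0r; exact: sE.
have [s' [t' fE]] : dterm n.+1 (fun e => c%:R * f e + f e).
  by apply: dtermD => //; exists s, t.
by exists s', t' => e; rewrite -fE mulrSr mulrDl mul1r.
Qed.

Lemma dtermMz n f (c : int) : dterm n.+1 f -> dterm n.+1 (fun e => c%:~R * f e).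
Proof.
move=> df; case: c => c; first exact: dtermMn.
have [s [t fE]] := dtermN (dtermMn c.+1 df).
by exists s, t => e; rewrite -fE NegzE mulrNz mulNr.
Qed.

Lemma dfn_imp n P Q : dfn n P -> dfn n Q -> dfn n (fun e => P e -> Q e).
Proof. by move=> [A AP] [B BQ]; exists (Fimp A B) => e /=; rewrite AP BQ. Qed.

Lemma dfn_not n P : dfn n P -> dfn n (fun e => ~ P e).
Proof. by move=> [A AP]; exists (Fimp A (Fbot LL n)) => e /=; rewrite AP. Qed.

Lemma dfn_iff n P Q : (forall e, P e <-> Q e) -> dfn n P -> dfn n Q.
Proof. by move=> PQ [A AP]; exists A => e; rewrite AP. Qed.

Lemma dfn_and n P Q : dfn n P -> dfn n Q -> dfn n (fun e => P e /\ Q e).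
Proof.
move=> dP dQ; apply: dfn_iff (dfn_not (dfn_imp dP (dfn_not dQ))) => e.
split=> [H|[? ?] H]; last exact: H.
by apply: contrapT => nPQ; apply: H => Pe Qe; apply: nPQ.
Qed.

Lemma dfn_or n P Q : dfn n P -> dfn n Q -> dfn n (fun e => P e \/ Q e).
Proof.
move=> dP dQ; apply: dfn_iff (dfn_imp (dfn_not dP) dQ) => e.
by split=> [H|[]//]; case: (pselect (P e)) => ?; [left|right; apply: H].
Qed.

Lemma dfn_all n (P : (nat -> R) -> R -> Prop) :
  dfn n.+1 (fun e => P (fun i => e i.+1) (e 0%N)) -> dfn n (fun e => forall x, P e x).
Proof.
move=> [A AP]; exists (Fall A) => e /=.
have sE x : scons x (fun i : 'I_n => e i) =
    (fun i : 'I_n.+1 => (fun k => if k is j.+1 then e j else x) i).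
  by apply/funext => i; rewrite /scons; case: unliftP => [j ->|->].
have AP' x := AP (fun k => if k is j.+1 then e j else x).
by split=> H x; move: (H x); rewrite sE; case: (AP' x).
Qed.

Lemma dfn_ex n (P : (nat -> R) -> R -> Prop) :
  dfn n.+1 (fun e => P (fun i => e i.+1) (e 0%N)) -> dfn n (fun e => exists x, P e x).
Proof.
move=> dP; have dN := dfn_not dP.
apply: dfn_iff (dfn_not (dfn_all (P := fun e x => ~ P e x) dN)) => e.
split=> [/existsNP[x /contrapT Px]|[x Px] H]; first by exists x.
exact: (H x).
Qed.

(** The index is not an element of the structure: the quantifier unfolds into a finite disjunction.
    Bounded integer coefficients enter formulas in this way. *)
Lemma dfn_exord n K (P : 'I_K -> (nat -> R) -> Prop) :
  (forall i, dfn n (P i)) -> dfn n (fun e => exists i, P i e).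
Proof.
elim: K P => [|K IH] P dP.
  by exists (Fbot LL n) => e; split=> // -[[]].
have dO := dfn_or (dP ord0) (IH _ (fun i => dP (lift ord0 i))).
apply: dfn_iff dO => e; split=> [[|[i]] H|[i]]; [by exists ord0|by exists (lift ord0 i)|].
by case: (unliftP ord0 i) => [j|] ->; [right; exists j|left].
Qed.

Lemma dfn_lt n f g : dterm n f -> dterm n g -> dfn n (fun e => f e < g e).
Proof.
move=> [s [t fE]] [s' [t' gE]].
exists (Fpred (p := Less : pred_sym LL)
   (fun i : 'I_2 => if i == ord0 then tadd s t' else tadd s' t)) => e.
rewrite fE gE.
pose ev r : R := eval (M := M) (fun i : 'I_n => e i) r.
rewrite -/(ev s) -/(ev t) -/(ev s') -/(ev t').
by change (ev s + ev t' < ev s' + ev t <-> ev s - ev t < ev s' - ev t'); split=> H; lra.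
Qed.

Lemma dfn_le n f g : dterm n f -> dterm n g -> dfn n (fun e => f e <= g e).
Proof.
move=> df dg; apply: dfn_iff (dfn_not (dfn_lt dg df)) => e.
by rewrite leNgt; split=> /negP.
Qed.

Lemma dfn_eq n f g : dterm n f -> dterm n g -> dfn n (fun e => f e = g e).
Proof.
move=> df dg; apply: dfn_iff (dfn_and (dfn_le df dg) (dfn_le dg df)) => e.
by split=> [[fg gf]|->//]; apply/eqP; rewrite eq_le fg gf.
Qed.

Lemma dfn_inZ n k : (k < n)%N -> dfn n (fun e => exists c : int, e k = c%:~R).
Proof.
by move=> kn; exists (Fpred (p := InZ : pred_sym LL) (fun=> Tvar LL (Ordinal kn))).
Qed.

Lemma dfn_inZsqrt n k :
  (k < n)%N -> dfn n (fun e => exists c : int, e k = c%:~R * Num.sqrt (ratr d)).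
Proof.
by move=> kn; exists (Fpred (p := InZsqrt : pred_sym LL) (fun=> Tvar LL (Ordinal kn))).
Qed.

Lemma dfn_definable_fun (f : R -> R) :
  dfn 2 (fun e => e 1%N = f (e 0%N)) -> definable_fun (M := M) f.
Proof.
move=> [A AP]; exists A => v.
have := AP (fun i => v (inord i)).
have -> : (fun i : 'I_2 => v (inord i)) = v by apply/funext => i; rewrite inord_val.
have -> : inord 1 = ord_max :> 'I_2 by apply/ord_inj; rewrite inordK.
by have -> : inord 0 = ord0 :> 'I_2 by apply/ord_inj; rewrite inordK.
Qed.

End Definability.

(** * Pigeonhole, integer squares and Dirichlet approximation *)

Lemma pigeonhole_ord (T : finType) (f : nat -> T) :
  exists i j : nat, [/\ (i < j)%N, (j <= #|T|)%N & f i = f j].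
Proof.
have /injectivePn[x [y neq_xy fE]] : ~~ injectiveb (fun i : 'I_(#|T|).+1 => f i).
  by apply/negP => /injectiveP/leq_card; rewrite card_ord ltnn.
case: (ltngtP x y) => [lt|lt|/val_inj eq]; last by rewrite eq eqxx in neq_xy.
- by exists x, y; split=> //; rewrite -ltnS.
- by exists y, x; split=> //; rewrite -ltnS.
Qed.

Lemma absz_inj_ge0 (x y : int) : 0 <= x -> 0 <= y -> `|x|%N = `|y|%N -> x = y.
Proof. lia. Qed.

Lemma mulz_eq1_gt0 (x y : int) : x * y = 1 -> 0 < y -> y = 1.
Proof. by case: (leP x 0) => *; nia. Qed.

Lemma square_of_ratio_square (N : nat) (n m : int) :
  n ^+ 2 = N%:Z * m ^+ 2 -> m != 0 -> exists k, N = (k ^ 2)%N.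
Proof.
move=> E m0.
have {}E : (`|n| ^ 2 = N * `|m| ^ 2)%N by nia.
have m1 : (0 < `|m|)%N by rewrite absz_gt0.
have /dvdnP[k kE] : (`|m| %| `|n|)%N by rewrite -(@dvdn_pexp2r _ _ 2) // E dvdn_mull.
exists k; move: E; rewrite kE expnMn => /eqP.
by rewrite eqn_pmul2r ?expn_gt0 ?m1 // => /eqP.
Qed.

Lemma dirichlet_approx (R : realType) (x : R) (Q : nat) :
  (0 < Q)%N -> exists p q : int, [/\ 1 <= q, q <= Q%:Z & `|p%:~R - q%:~R * x| * Q%:R < 1].
Proof.
case: Q => // Q _; set Q1 : R := Q.+1%:R.
have Q1_gt0 : 0 < Q1 by rewrite ltr0n.
pose fr (i : nat) : R := i%:R * x - (Num.floor (i%:R * x))%:~R.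
have fr_itv i : 0 <= fr i < 1.
  have /andP[] := floor_itv (i%:R * x); rewrite intrD /fr => *; lra.
have trE i : 0 <= Q1 * fr i by have /andP[? _] := fr_itv i; apply: mulr_ge0 => //; lra.
(* The fractional parts of the multiples of [x] are sorted into [Q.+1] boxes of equal length; two of
   them share a box. *)
have [i [j [ij jQ fij]]] :=
  pigeonhole_ord (fun i => inord (Num.truncn (Q1 * fr i)) : 'I_Q.+1).
rewrite card_ord in jQ.
have tr_lt k : (Num.truncn (Q1 * fr k) < Q.+1)%N.
  have /andP[h _] := truncn_itv (trE k); rewrite -(ltr_nat R).
  by apply: le_lt_trans h _; have /andP[_ h] := fr_itv k; rewrite -/Q1; nra.
move: fij => /(congr1 val); rewrite /= !inordK // => fij.
have /andP[] := truncn_itv (trE i); have /andP[] := truncn_itv (trE j).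
rewrite fij -natr1; move: (_%:R : R) => t h1 h2 h3 h4.
exists (Num.floor (j%:R * x) - Num.floor (i%:R * x)), (j%:Z - i%:Z).
split; [lia|lia|].
rewrite -(gtr0_norm Q1_gt0) -normrM.
rewrite [X in `|X|](_ : _ = Q1 * fr i - Q1 * fr j); last first.
  by rewrite /fr !intrD !mulrNz -!pmulrn; ring.
by rewrite ltr_norml; apply/andP; split; lra.
Qed.

(** * Solvability of Pell's equation *)

Section Pell.
Context {R : realType} (N : nat) (al : R) (a : nat).
Hypothesis al2 : al ^+ 2 = N%:R.
Hypothesis Nsq : forall k, N <> (k ^ 2)%N.
Hypothesis a_lt : a%:R < al.
Hypothesis al_lt : al < a%:R + 1.

Lemma al_gt0 : 0 < al.
Proof. exact: le_lt_trans (ler0n R a) a_lt. Qed.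

Lemma norm_eq0 (n m : int) : n ^+ 2 = N%:Z * m ^+ 2 -> n = 0 /\ m = 0.
Proof.
move=> E; have [m0|/(square_of_ratio_square E)[k /Nsq]//] := eqVneq m 0.
split=> //; move: E; rewrite m0 expr0n mulr0 => /eqP.
by rewrite expf_eq0 => /eqP.
Qed.

Lemma norm_mulE (n m : int) : (n%:~R + m%:~R * al) * (n%:~R - m%:~R * al) =
  (n ^+ 2 - N%:Z * m ^+ 2)%:~R.
Proof.
rewrite intrD mulrNz intrM !rmorphXn /= -pmulrn -al2; ring.
Qed.

Lemma lattice_eq0 (n m : int) : n%:~R + m%:~R * al = 0 -> n = 0 /\ m = 0.
Proof.
move=> E; apply: norm_eq0; move: (norm_mulE n m); rewrite E mul0r => /esym/eqP.
by rewrite intr_eq0 subr_eq0 => /eqP.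
Qed.

(** For a Dirichlet approximation, [w = p - q al] satisfies [|w| q <= 1], and the norm is
    [w (w + 2 q al)], of size at most [1 + 2 al < 2 a + 3]. *)
Lemma small_norm_points (del : R) : 0 < del -> exists z : int * int,
  [/\ 0 < `|z.1%:~R - z.2%:~R * al|, `|z.1%:~R - z.2%:~R * al| < del
    & `|z.1 ^+ 2 - N%:Z * z.2 ^+ 2| <= 2 * a%:Z + 3].
Proof.
move=> del0; have al0 := al_gt0; have alS := al_lt; have aR := ler0n R a.
have := truncnS_gt del^-1; set Q := Num.truncn _; move=> hQ.
have [//|p [q [q1 qQ pq]]] := @dirichlet_approx R al Q.+1.
exists (p, q) => /=; set w := _ - _ in pq *.
have Qd : 1 < Q.+1%:R * del by rewrite -ltr_pdivrMr // mul1r.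
have Q1 : 1 <= Q.+1%:R :> R by rewrite ler1n.
have w0 : 0 < `|w|.
  rewrite normr_gt0; apply/eqP => E.
  by have [|_ q0] := @lattice_eq0 p (- q); [rewrite mulrNz mulNr|lia].
split=> //; first by nra.
rewrite -(ler_int R) intr_norm -norm_mulE -/w normrM.
have q1R : 1 <= q%:~R :> R by rewrite -(ler_int R) in q1.
have qQR : q%:~R <= Q.+1%:R :> R by rewrite -(ler_int R) in qQ.
have w1 : `|w| * q%:~R <= 1.
  by apply: (le_trans _ (ltW pq)); rewrite ler_pM2l.
have -> : p%:~R + q%:~R * al = w + 2 * (q%:~R * al) by rewrite /w; ring.
have h := ler_normD w (2 * (q%:~R * al)).
have hn : `|2 * (q%:~R * al)| = 2 * (q%:~R * al).
  by rewrite ger0_norm // mulr_ge0 // mulr_ge0 //; lra.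
rewrite hn in h.
rewrite intrD intrM -pmulrn.
have : `|w + 2 * (q%:~R * al)| * `|w| <= (`|w| + 2 * (q%:~R * al)) * `|w| by rewrite ler_pM2r.
move/le_trans; apply.
have : `|w| <= 1 by nra.
have -> : (`|w| + 2 * (q%:~R * al)) * `|w| = `|w| * `|w| + 2 * al * (`|w| * q%:~R) by ring.
move: `|w| w0 w1 => ww *; nra.
Qed.

(* Two points of small norm with equal norm D and congruent coordinates mod D
   have a quotient of norm 1 in the lattice. *)
Lemma pell : exists p q : int, [/\ 0 < p, 0 < q & p ^+ 2 - N%:Z * q ^+ 2 = 1].
Proof.
have /choice[g gP] : forall r : R, exists z : int * int, 0 < r ->
  [/\ 0 < `|z.1%:~R - z.2%:~R * al|, `|z.1%:~R - z.2%:~R * al| < r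
    & `|z.1 ^+ 2 - N%:Z * z.2 ^+ 2| <= 2 * a%:Z + 3].
  move=> r; case: (pselect (0 < r)) => r0; last by exists (0, 0).
  by have [z zP] := small_norm_points r0; exists z.
pose sz (z : int * int) : R := `|z.1%:~R - z.2%:~R * al|.
pose nm (z : int * int) : int := z.1 ^+ 2 - N%:Z * z.2 ^+ 2.
(* The conjugate of each point bounds that of the next, so the sizes strictly decrease and the
   points are distinct. *)
pose Z k := iter k (fun z => g (sz z)) (g 1).
have ZP k : 0 < sz (Z k) /\ `|nm (Z k)| <= 2 * a%:Z + 3.
  elim: k => [|k [IH _]]; first by have [//|? _ ?] := gP 1.
  by have [//|? _ ?] := gP (sz (Z k)).
have Zdec k : sz (Z k.+1) < sz (Z k) by have [|] := gP (sz (Z k)); first by case: (ZP k).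
have Zlt i j : (i < j)%N -> sz (Z j) < sz (Z i).
  elim: j => // j IH; rewrite ltnS leq_eqVlt => /predU1P[->//|/IH].
  exact: lt_trans.
(* Shifted norms are at most [4 a + 6] and residues are below [2 a + 3], so [inord] loses no
   information. *)
pose B := (4 * a + 10)%N.
pose lab (z : int * int) : 'I_B.+1 * 'I_B.+1 * 'I_B.+1 :=
  (inord `|nm z + 2 * a%:Z + 3|, inord `|(z.1 %% nm z)%Z|, inord `|(z.2 %% nm z)%Z|).
have [i [j [ij _]]] := pigeonhole_ord (fun k => lab (Z k)).
have [zi_gt0 nmi] := ZP i; have [zj_gt0 nmj] := ZP j; have := Zlt _ _ ij.
move: (Z i) (Z j) zi_gt0 nmi zj_gt0 nmj => z w z0 nz w0 nw wz.
case=> /(congr1 val) + /(congr1 val) + /(congr1 val).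
have nm0 x : 0 < sz x -> nm x != 0.
  rewrite /sz normr_gt0; apply: contra => /eqP; rewrite /nm => /eqP.
  rewrite subr_eq0 => /eqP/norm_eq0[-> ->].
  by rewrite mul0r subr0.
have modB (x c : int) : c != 0 -> `|c| <= 2 * a%:Z + 3 -> (`|(x %% c)%Z| < B.+1)%N.
  by move=> c0 cB; have := ltz_mod x c0; have := modz_ge0 x c0; rewrite /B; lia.
have nz0 := nm0 _ z0; have nw0 := nm0 _ w0.
rewrite /= !inordK ?modB //; [|rewrite /B; lia..].
move=> E1 E2 E3; have nE : nm z = nm w.
  by apply/(@addIr _ (2 * a%:Z))/(@addIr _ 3)/(absz_inj_ge0 _ _ E1); clear - nz nw; lia.
have {}E2 : (nm w %| z.1 - w.1)%Z.
  rewrite -eqz_mod_dvd; apply/eqP; rewrite nE in E2.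
  by apply: absz_inj_ge0 E2; apply: modz_ge0.
have {}E3 : (nm w %| z.2 - w.2)%Z.
  rewrite -eqz_mod_dvd; apply/eqP; rewrite nE in E3.
  by apply: absz_inj_ge0 E3; apply: modz_ge0.
have /dvdzP[s sE] := E2; have /dvdzP[t tE] := E3.
move: nE nw0; rewrite /nm in sE tE *; set D := w.1 ^+ 2 - _ in sE tE * => nE D0.
(* [p + q al] is the quotient of [z] by [w], that is, [z] times the conjugate of [w] divided by [D];
   the congruences make it integral. *)
pose p := 1 + s * w.1 - N%:Z * t * w.2; pose q := t * w.1 - s * w.2.
have z1E : z.1 = w.1 + s * D by rewrite -sE addrC subrK.
have z2E : z.2 = w.2 + t * D by rewrite -tE addrC subrK.
have Dp : D * p = z.1 * w.1 - N%:Z * z.2 * w.2 by rewrite z1E z2E /p /D; ring.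
have Dq : D * q = z.2 * w.1 - z.1 * w.2 by rewrite z1E z2E /q; ring.
have pq1 : p ^+ 2 - N%:Z * q ^+ 2 = 1.
  apply: (mulfI D0); apply: (mulfI D0).
  transitivity ((D * p) ^+ 2 - N%:Z * (D * q) ^+ 2); first by ring.
  rewrite Dp Dq mulr1 -{1}nE /D; ring.
(* If [q = 0] then [|p| = 1], and [z] and [w] would have conjugates of equal size, against the
   strict decrease. *)
have q0 : q != 0.
  apply/eqP => q0; rewrite q0 expr0n mulr0 subr0 in pq1.
  have p1 : `|p| = 1.
    by apply/eqP; rewrite -(@eqrXn2 _ 2) ?normr_ge0 // expr1n -normrX pq1 normr1.
  suff : sz z = sz w by move=> E; rewrite E ltxx in wz.
  have zwE : (z.1%:~R - z.2%:~R * al) * (w.1%:~R + w.2%:~R * al) = (D * p)%:~R.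
    have : (z.1 * w.2 - z.2 * w.1)%:~R = 0 :> R by rewrite -opprB -Dq q0 mulr0 oppr0.
    rewrite Dp !intrD !mulrNz !intrM -pmulrn -al2 => h.
    transitivity (z.1%:~R * w.1%:~R + - (al ^+ 2 * z.2%:~R * w.2%:~R) +
      al * (z.1%:~R * w.2%:~R - z.2%:~R * w.1%:~R)); first by ring.
    by rewrite h mulr0 addr0.
  have wwE : (w.1%:~R - w.2%:~R * al) * (w.1%:~R + w.2%:~R * al) = D%:~R.
    by rewrite mulrC norm_mulE.
  have w'0 : `|w.1%:~R + w.2%:~R * al| != 0.
    rewrite normr_eq0; apply/eqP => E; move: wwE; rewrite E mulr0 => /esym/eqP.
    by rewrite intr_eq0 (negbTE D0).
  by apply: (mulIf w'0); rewrite /sz -!normrM zwE wwE intrM normrM -(intr_norm _ p) p1 mulr1.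
exists `|p|, `|q|; split; rewrite ?normr_gt0 //; last by rewrite -!normrX !ger0_norm ?sqr_ge0.
apply/eqP => p0; have : 0 <= N%:Z * q ^+ 2 by rewrite mulr_ge0 ?sqr_ge0.
by move: pq1; rewrite p0 expr0n; clear; lia.
Qed.

End Pell.

(** * The lattice Z + Z al *)

Section Lattice.
Context {R : realType} (N : nat) (al : R) (a : nat).
Hypothesis al2 : al ^+ 2 = N%:R.
Hypothesis Nsq : forall k, N <> (k ^ 2)%N.
Hypothesis a_gt0 : (0 < a)%N.
Hypothesis a_lt : a%:R < al.
Hypothesis al_lt : al < a%:R + 1.

Definition lval (n m : int) : R := n%:~R + m%:~R * al.
Definition lconj (n m : int) : R := n%:~R - m%:~R * al.
Definition lunit (n m : int) := n ^+ 2 - N%:Z * m ^+ 2 = 1 /\ 0 < lval n m.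

Let a1 : 1 <= a%:R :> R. Proof. by rewrite ler1n. Qed.

Lemma lvalM n m p q : lval (n * p + N%:Z * m * q) (n * q + m * p) = lval n m * lval p q.
Proof. by rewrite /lval !intrD !intrM -!pmulrn -al2; ring. Qed.

Lemma lconjM n m p q : lconj (n * p + N%:Z * m * q) (n * q + m * p) = lconj n m * lconj p q.
Proof. by rewrite /lconj !intrD !intrM -!pmulrn -al2; ring. Qed.

Lemma lvalal n m : lval (N%:Z * m) n = al * lval n m.
Proof. by rewrite /lval !intrM -!pmulrn -al2; ring. Qed.

Lemma lconjal n m : lconj (N%:Z * m) n = - al * lconj n m.
Proof. by rewrite /lconj !intrM -!pmulrn -al2; ring. Qed.

Lemma lvalB n m p q : lval (n - p) (m - q) = lval n m - lval p q.
Proof. by rewrite /lval !intrD !mulrNz; ring. Qed.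

Lemma lconjB n m p q : lconj (n - p) (m - q) = lconj n m - lconj p q.
Proof. by rewrite /lconj !intrD !mulrNz; ring. Qed.

Lemma lvalN n m : lval n (- m) = lconj n m.
Proof. by rewrite /lval /lconj mulrNz mulNr. Qed.

Lemma lconjN n m : lconj n (- m) = lval n m.
Proof. by rewrite /lval /lconj mulrNz mulNr opprK. Qed.

Lemma lval_conj_inj n m p q : lval n m = lval p q -> lconj n m = lconj p q -> n = p /\ m = q.
Proof.
move=> Ev Ec; suff [? ?] : n - p = 0 /\ m - q = 0.
  by split; apply/eqP; rewrite -subr_eq0; apply/eqP.
apply: (lattice_eq0 al2 Nsq); move: (lvalB n m p q); rewrite /lval => ->.
by apply/eqP; rewrite subr_eq0; apply/eqP.
Qed.

Lemma lunit_inv n m : lunit n m -> lval n m * lconj n m = 1.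
Proof. by case=> E _; rewrite /lval /lconj (norm_mulE al2) E. Qed.

Lemma lunit_conj_gt0 n m : lunit n m -> 0 < lconj n m.
Proof. by move=> u; have := lunit_inv u; case: u => _; nra. Qed.

Lemma lunitM n m p q : lunit n m -> lunit p q ->
  lunit (n * p + N%:Z * m * q) (n * q + m * p).
Proof.
move=> [u1 u0] [w1 w0]; split; last by rewrite lvalM mulr_gt0.
transitivity ((n ^+ 2 - N%:Z * m ^+ 2) * (p ^+ 2 - N%:Z * q ^+ 2)); first by ring.
by rewrite u1 w1 mulr1.
Qed.

Lemma lunitV n m : lunit n m -> lunit n (- m).
Proof.
by move=> u; split; [case: u => <- _; rewrite sqrrN|rewrite lvalN; apply: lunit_conj_gt0].
Qed.

Lemma lunit10 : lunit 1 0.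
Proof. by split; rewrite /lval ?mul0r ?addr0 ?ltr01 //; ring. Qed.

Lemma lunit_ge2 : exists p q, lunit p q /\ 2 <= lval p q.
Proof.
have [p [q [p0 q0 E]]] := pell al2 Nsq a_lt al_lt.
have pR : 1 <= p%:~R :> R by rewrite ler1z; lia.
have qR : 1 <= q%:~R :> R by rewrite ler1z; lia.
have a1' := a1; have al' := a_lt; have h : 2 <= lval p q by rewrite /lval; nra.
by exists p, q; split=> //; split=> //; lra.
Qed.

(** Powers of the unit from [lunit_ge2] at least double at each step. *)
Lemma lunit_large (r : R) : exists n m, lunit n m /\ r < lval n m.
Proof.
have [p [q [e e2]]] := lunit_ge2.
suff H k : exists n m, lunit n m /\ k.+1%:R <= lval n m.
  have [n [m [? h]]] := H (Num.truncn r).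
  by exists n, m; split=> //; apply: lt_le_trans h; apply: truncnS_gt.
elim: k => [|k [n [m [u IH]]]].
  by exists 1, 0; split; [exact: lunit10|rewrite /lval mul0r addr0].
exists (n * p + N%:Z * m * q), (n * q + m * p); split; first exact: lunitM.
rewrite lvalM; have k1 : 1 <= k.+1%:R :> R by rewrite ler1n.
rewrite -natr1; move: (k.+1%:R : R) k1 IH => t *; nra.
Qed.

(** * Bounded coordinates and greatest lattice points *)

Lemma coord_bound (K : nat) n m : `|lval n m| <= K%:R -> `|lconj n m| <= K%:R ->
  `|n| <= K%:Z /\ `|m| <= K%:Z.
Proof.
rewrite /lval /lconj -!(ler_int R) !intr_norm -!pmulrn !ler_norml.
have a1' := a1; have al' := a_lt; have K0 := ler0n R K.
move: (n%:~R : R) (m%:~R : R) (K%:R : R) K0 => x y k k0 /andP[h1 h2] /andP[h3 h4].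
have h5 : y * al <= k by lra.
have h6 : - k <= y * al by lra.
by split; apply/andP; split; [lra|lra|nra|nra].
Qed.

(** Shifts the index type to the integers from [- K] to [K], so that a bounded integer can be
    quantified by a finite disjunction. *)
Definition digit (K : nat) (i : 'I_(2 * K).+1) : int := i%:Z - K%:Z.

Lemma digitP (K : nat) (n : int) : `|n| <= K%:Z -> exists i : 'I_(2 * K).+1, n = digit i.
Proof.
by move=> nK; exists (inord `|n + K%:Z|); rewrite /digit inordK; lia.
Qed.

Lemma lattice_max (P : int -> int -> Prop) (B : nat) (F : int -> int -> R) :
  (exists n m, P n m) -> (forall n m, P n m -> `|n| <= B%:Z /\ `|m| <= B%:Z) ->
  exists n m, P n m /\ forall p q, P p q -> F p q <= F n m.
Proof.
move=> [n [m Pnm]] PB.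
have [i0 i0E] := digitP (PB _ _ Pnm).1; have [j0 j0E] := digitP (PB _ _ Pnm).2.
pose Q (ij : 'I_(2 * B).+1 * 'I_(2 * B).+1) := `[< P (digit ij.1) (digit ij.2) >].
have Q0 : Q (i0, j0) by apply/asboolP; rewrite /= -i0E -j0E.
case: (arg_maxP (fun ij => F (digit ij.1) (digit ij.2)) Q0) => ij /asboolP Pij ijmax.
exists (digit ij.1), (digit ij.2); split=> // p q Ppq.
have [i iE] := digitP (PB _ _ Ppq).1; have [j jE] := digitP (PB _ _ Ppq).2.
by have := ijmax (i, j); rewrite /= -iE -jE; apply; apply/asboolP; rewrite /= -iE -jE.
Qed.

(* The window of scale [u = n + m al] below [x]; [win_max] gives s_u(x). *)
Definition win n m (x : R) p q :=
  lval p q <= x /\ `|lconj p q| <= (a%:R + 2) * lconj n m.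

(** Division by [u] reduces to approximating [r = x / u]. Halving [r] between the two coordinates
    and rounding down gives [f + g al] with error below [1 + al < a + 2], while the conjugate
    [f - g al] stays within [a + 2] because the halves cancel. *)
Lemma win_gap n m x : lunit n m ->
  exists p q, win n m x p q /\ x - (a%:R + 2) * lval n m <= lval p q.
Proof.
move=> u; have c0 := lunit_conj_gt0 u; have E := lunit_inv u; have [_ v0] := u.
have a1' := a1; have al' := a_lt; have al'' := al_lt.
pose r := x * lconj n m.
have /andP[f1 f2] := floor_itv (r / 2); have /andP[g1 g2] := floor_itv (r / 2 / al).
move: (Num.floor (r / 2)) (Num.floor (r / 2 / al)) f1 f2 g1 g2 => f g f1 f2 g1 g2.
rewrite intrD in f2; rewrite intrD ltr_pdivrMr in g2; last lra.
rewrite ler_pdivlMr in g1; last lra.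
exists (f * n + N%:Z * g * m), (f * m + g * n).
have rE : r * lval n m = x by rewrite /r -mulrA (mulrC (lconj _ _)) E mulr1.
rewrite /win lvalM lconjM -rE normrM (gtr0_norm c0).
have h1 : lval f g <= r by rewrite /lval; lra.
have h2 : r - (a%:R + 2) <= lval f g by rewrite /lval; lra.
have h3 : `|lconj f g| <= a%:R + 2 by rewrite /lconj ler_norml; apply/andP; split; lra.
by split; [split; rewrite ?ler_pM2r|rewrite -mulrBl ler_pM2r].
Qed.

Lemma win_max n m x : lunit n m ->
  exists p q, [/\ win n m x p q, x - (a%:R + 2) * lval n m <= lval p q &
    forall p' q', win n m x p' q' -> lval p' q' <= lval p q].
Proof.
move=> u; have [p0 [q0 [w0 g0]]] := win_gap x u.
(* The window is unbounded below; cutting it at the point from [win_gap] bounds the coordinates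
   without changing the maximum. *)
pose P p q := win n m x p q /\ lval p0 q0 <= lval p q.
pose r := `|x| + `|lval p0 q0| + (a%:R + 2) * lconj n m.
have c0 := lunit_conj_gt0 u; have a1' := a1.
have cc : 0 <= (a%:R + 2) * lconj n m by apply: mulr_ge0; lra.
have [|p q|p [q [[wpq p0q] pmax]]] := @lattice_max P (Num.truncn r).+1 lval.
- by exists p0, q0; split.
- move=> [[h1 h2] h3]; have rB : r <= (Num.truncn r).+1%:R by exact/ltW/truncnS_gt.
  have := ler_norm x; have := ler_norm (- lval p0 q0); rewrite normrN => h4 h5.
  have := normr_ge0 x; have := normr_ge0 (lval p0 q0) => h6 h7.
  apply: coord_bound; apply: (le_trans _ rB); rewrite /r.
    by rewrite ler_norml; apply/andP; split; lra.
  by apply: (le_trans h2); lra.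
exists p, q; split=> //; first exact: le_trans p0q.
move=> p' q' w'; have [h|h] := leP (lval p0 q0) (lval p' q'); first exact: pmax.
exact: le_trans (ltW h) p0q.
Qed.

(** * Definable units and the definable graph *)

Definition in_lattice (z1 z2 : R) :=
  (exists c : int, z1 = c%:~R) /\ (exists c : int, z2 = c%:~R * al).

(** For positive [u] and [u'], this is [a < w / u < a + 1] and [a < - w' / u' < a + 1] with
    denominators cleared. *)
Definition slope_box (u1 u2 w1 w2 : R) :=
  (a%:R * (u1 + u2) < w1 + w2 /\ w1 + w2 < a.+1%:R * (u1 + u2)) /\
  (a%:R * (u1 - u2) < w2 - w1 /\ w2 - w1 < a.+1%:R * (u1 - u2)).

Definition small (c : R) (x : R) := - c <= x /\ x <= c.

Definition unit_rel (K : nat) (u1 u2 v1 v2 : R) :=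
  (in_lattice u1 u2 /\ in_lattice v1 v2) /\ (0 < u1 + u2 /\ 0 < u1 - u2) /\
  slope_box u1 u2 v1 v2 /\
  (forall w1 w2, in_lattice w1 w2 -> slope_box u1 u2 w1 w2 -> w1 = v1 /\ w2 = v2) /\
  (forall z1 z2, in_lattice z1 z2 ->
     small (K%:R * (u1 + u2)) (z1 + z2) -> small (K%:R * (u1 - u2)) (z1 - z2) ->
     exists i j : 'I_(2 * K).+1, z1 = (digit i)%:~R * u1 + (digit j)%:~R * v1 /\
       z2 = (digit i)%:~R * u2 + (digit j)%:~R * v2).

Lemma in_latticeP z1 z2 :
  in_lattice z1 z2 <-> exists p q : int, z1 = p%:~R /\ z2 = q%:~R * al.
Proof.
split=> [[[p ->] [q ->]]|[p [q [-> ->]]]]; first by exists p, q.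
by split; [exists p|exists q].
Qed.

Lemma smallE c x : small c x <-> `|x| <= c.
Proof. by rewrite ler_norml; split=> [[-> ->]|/andP[]]. Qed.

(** Since [al u] always lies in the slope box, uniqueness identifies [v] with it, and the covering
    clause then makes [u] invertible. Conversely, dividing by a unit [u] reduces both clauses to the
    case [u = 1]. The bound on [K] covers remainders of size up to [(1 + al) u]. *)
Lemma unit_relP K u1 u2 v1 v2 : (a.+2 <= K)%N -> unit_rel K u1 u2 v1 v2 <->
  exists n m : int, [/\ u1 = n%:~R, u2 = m%:~R * al, v1 = (N%:Z * m)%:~R,
    v2 = n%:~R * al & lunit n m].
Proof.
move=> aK; have a1' := a1; have al' := a_lt; have al'' := al_lt.
have KR : a%:R + 2 <= K%:R :> R by rewrite -natrD ler_nat addn2.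
have al_pos : 0 < al by lra.
split.
- case=> [[/in_latticeP[n [m [-> ->]]] _]] [[v0 c0]] [_ [vuniq sml]].
  exists n, m; rewrite -/(lval n m) -/(lconj n m) in v0 c0 vuniq sml.
  have [v1E v2E] : (N%:Z * m)%:~R = v1 /\ n%:~R * al = v2.
    apply: vuniq; first by apply/in_latticeP; exists (N%:Z * m), n.
    have E1 : (N%:Z * m)%:~R + n%:~R * al = al * lval n m by rewrite -lvalal.
    have E2 : n%:~R * al - (N%:Z * m)%:~R = al * lconj n m.
      by rewrite -opprB -/(lconj (N%:Z * m) n) lconjal; ring.
    by rewrite /slope_box E1 E2 -/(lval n m) -/(lconj n m) -natr1 !ltr_pM2r.
  rewrite -v1E -v2E in sml *; split=> //; split=> //.
  (* Reduce 1 modulo the sublattice spanned by u and al * u: the remainder is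
     small, hence lies in that sublattice, so that u divides 1. *)
  pose r := ((lval n m)^-1 + (lconj n m)^-1) / 2.
  pose s := ((lval n m)^-1 - (lconj n m)^-1) / 2 / al.
  have rsv : (r + s * al) * lval n m = 1 by rewrite /r /s; field; rewrite !gt_eqF.
  have rsc : (r - s * al) * lconj n m = 1 by rewrite /r /s; field; rewrite !gt_eqF.
  have /andP[f1 f2] := floor_itv r; have /andP[g1 g2] := floor_itv s.
  move: (Num.floor r) (Num.floor s) f1 f2 g1 g2 => f g f1 f2 g1 g2.
  rewrite intrD in f2; rewrite intrD in g2.
  have gal1 : 0 <= (s - g%:~R) * al by apply: mulr_ge0; lra.
  have gal2 : (s - g%:~R) * al <= al by rewrite -[leRHS]mul1r ler_pM2r //; lra.
  pose z1 := 1 - (f * n + N%:Z * g * m); pose z2 := 0 - (f * m + g * n).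
  have zv : lval z1 z2 = (r - f%:~R + (s - g%:~R) * al) * lval n m.
    rewrite lvalB lvalM {1}/lval mul0r addr0 -[X in X - _]rsv /lval; ring.
  have zc : lconj z1 z2 = (r - f%:~R - (s - g%:~R) * al) * lconj n m.
    rewrite lconjB lconjM {1}/lconj mul0r subr0 -[X in X - _]rsc /lconj; ring.
  have [|||i [j [h1 h2]]] := sml z1%:~R (z2%:~R * al).
  + by apply/in_latticeP; exists z1, z2.
  + apply/smallE; rewrite -/(lval z1 z2) zv normrM (gtr0_norm v0) ler_pM2r //.
    by rewrite ler_norml; apply/andP; split; lra.
  + apply/smallE; rewrite -/(lconj z1 z2) zc normrM (gtr0_norm c0) ler_pM2r //.
    by rewrite ler_norml; apply/andP; split; lra.
  move: (digit i) (digit j) h1 h2 => ci cj h1 h2; pose G := f + ci; pose H := g + cj.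
  have Gv : lval G H * lval n m = 1.
    have : lval z1 z2 = lval ci cj * lval n m.
      by rewrite -lvalM /lval h1 h2 !intrD !intrM; ring.
    have -> : lval G H = lval f g + lval ci cj by rewrite /lval /G /H !intrD; ring.
    move=> h; rewrite mulrDl -h zv -[RHS]rsv /lval; ring.
  have Gc : lconj G H * lconj n m = 1.
    have : lconj z1 z2 = lconj ci cj * lconj n m.
      by rewrite -lconjM /lconj h1 h2 !intrD !intrM; ring.
    have -> : lconj G H = lconj f g + lconj ci cj by rewrite /lconj /G /H !intrD; ring.
    move=> h; rewrite mulrDl -h zc -[RHS]rsc /lconj; ring.
  (* The norm of [u] divides 1 and is positive, as both [u] and [u'] are; hence it is 1. *)
  have NN : (G ^+ 2 - N%:Z * H ^+ 2) * (n ^+ 2 - N%:Z * m ^+ 2) = 1.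
    apply/eqP; rewrite -(eqr_int R) intrM -!(norm_mulE al2) -!/(lval _ _) -!/(lconj _ _).
    by rewrite mulrACA Gv Gc mulr1.
  have Npos : 0 < n ^+ 2 - N%:Z * m ^+ 2.
    by rewrite -(ltr_int R) -(norm_mulE al2); apply: mulr_gt0.
  exact: mulz_eq1_gt0 NN Npos.
- move=> [n [m [-> -> -> -> u]]].
  have c0 := lunit_conj_gt0 u; have E := lunit_inv u; have [_ v0] := u.
  have E1 : (N%:Z * m)%:~R + n%:~R * al = al * lval n m by rewrite -lvalal.
  have E2 : n%:~R * al - (N%:Z * m)%:~R = al * lconj n m.
    by rewrite -opprB -/(lconj (N%:Z * m) n) lconjal; ring.
  have unitE : n%:~R * n%:~R - N%:R * m%:~R * m%:~R = 1 :> R.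
    by rewrite -[RHS]E /lval /lconj -al2; ring.
  rewrite /unit_rel /slope_box E1 E2 -/(lval n m) -/(lconj n m).
  split; first by split; apply/in_latticeP; [exists n, m|exists (N%:Z * m), n].
  split=> //; split; first by rewrite -natr1 !ltr_pM2r.
  split=> z1 z2 /in_latticeP[p [q [-> ->]]].
  + rewrite -/(lval p q) -[_ * al - _]opprB -/(lconj p q) => -[[h1 h2] [h3 h4]].
    (* [F + G al] is [(p + q al) / u], the inverse of a unit being its conjugate. *)
    pose F := p * n + N%:Z * q * - m; pose G := p * - m + q * n.
    have Fv : lval F G = lval p q * lconj n m by rewrite -lvalN -lvalM.
    have Fc : lconj F G = lconj p q * lval n m by rewrite -(lconjN n) -lconjM.
    rewrite -(ltr_pM2r c0) -mulrA E mulr1 -Fv in h1.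
    rewrite -(ltr_pM2r c0) -mulrA E mulr1 -Fv in h2.
    rewrite -(ltr_pM2r v0) -mulrA (mulrC (lconj _ _)) E mulr1 mulNr -Fc in h3.
    rewrite -(ltr_pM2r v0) -mulrA (mulrC (lconj _ _)) E mulr1 mulNr -Fc in h4.
    rewrite -natr1 in h2 h4.
    (* [2 F] is the sum of the quotient and its conjugate, which lie in [(a, a + 1)] and
       [(- a - 1, - a)], so [|2 F| < 1]. Then [G al] lies in [(a, a + 1)], and [a + 1 <= 2 a < 2 al]
       leaves only [G = 1]. *)
    have F0 : F = 0.
      have : -1 < F%:~R :> R by rewrite /lval /lconj in h1 h2 h3 h4; lra.
      have : F%:~R < 1 :> R by rewrite /lval /lconj in h1 h2 h3 h4; lra.
      by rewrite ltrz1 (_ : -1 = (-1)%:~R) // ltr_int; clear; lia.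
    have G1 : G = 1.
      rewrite /lval F0 add0r in h1 h2.
      have : 0 < G%:~R :> R by rewrite -(pmulr_lgt0 _ al_pos); lra.
      have : G%:~R < 2 :> R by rewrite -(ltr_pM2r al_pos); lra.
      by rewrite ltr0z (_ : 2 = (2 : int)%:~R) // ltr_int; clear; lia.
    have [-> ->//] : p = N%:Z * m /\ q = n.
    apply: lval_conj_inj.
      by rewrite lvalal -[LHS]mulr1 -E mulrCA mulrA -mulrA -Fv F0 G1 /lval mul1r add0r; ring.
    by rewrite lconjal -[LHS]mulr1 -E mulrA -Fc F0 G1 /lconj; ring.
  + rewrite -/(lval p q) -/(lconj p q) => /smallE h1 /smallE h2.
    pose F := p * n + N%:Z * q * - m; pose G := p * - m + q * n.
    have Fv : lval F G = lval p q * lconj n m by rewrite -lvalN -lvalM.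
    have Fc : lconj F G = lconj p q * lval n m by rewrite -(lconjN n) -lconjM.
    have [||FK GK] := @coord_bound K F G.
    * by rewrite Fv normrM (gtr0_norm c0); move: h1; rewrite -(ler_pM2r c0) -mulrA E mulr1.
    * rewrite Fc normrM (gtr0_norm v0); move: h2.
      by rewrite -(ler_pM2r v0) -mulrA (mulrC (lconj _ _)) E mulr1.
    have [i iE] := digitP FK; have [j jE] := digitP GK.
    exists i, j; rewrite -iE -jE /F /G !intrD !intrM !mulrNz -!pmulrn.
    by split; rewrite -[LHS]mulr1 -[X in _ * X = _]unitE; ring.
Qed.

Definition win_max_rel (u1 u2 x z1 z2 : R) :=
  in_lattice z1 z2 /\ z1 + z2 <= x /\ small (a.+2%:R * (u1 - u2)) (z1 - z2) /\
  forall w1 w2, in_lattice w1 w2 -> w1 + w2 <= x ->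
    small (a.+2%:R * (u1 - u2)) (w1 - w2) -> w1 + w2 <= z1 + z2.

(* The same greatest element in the image of the lattice under multiplication
   by [al]: the point [al * (c2 / al + c1 * al)] is [N * c1 + c2]. *)
Definition win_max_img (v1 v2 y c1 c2 : R) :=
  in_lattice c1 c2 /\ N%:R * c1 + c2 <= y /\ small (a.+2%:R * (v2 - v1)) (N%:R * c1 - c2) /\
  forall w1 w2, in_lattice w1 w2 -> N%:R * w1 + w2 <= y ->
    small (a.+2%:R * (v2 - v1)) (N%:R * w1 - w2) -> N%:R * w1 + w2 <= N%:R * c1 + c2.

(** As [v = al u] and [al v = N u], the last equation is [al] times the one before it, with the same
    digits; no multiplication by [al] is needed to state it. *)
Definition step_rel K (u1 u2 v1 v2 x y : R) :=
  exists u1' u2' v1' v2' : R, unit_rel K u1' u2' v1' v2' /\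
    2%:R * (u1 + u2) <= u1' + u2' /\
  exists z1 z2 z1' z2' c1 c2 c1' c2' : R,
    (win_max_rel u1 u2 x z1 z2 /\ win_max_rel u1' u2' x z1' z2') /\
    (win_max_img v1 v2 y c1 c2 /\ win_max_img v1' v2' y c1' c2') /\
  exists i j : 'I_(2 * K).+1,
    z1 + z2 - (z1' + z2') = (digit i)%:~R * (u1 + u2) + (digit j)%:~R * (v1 + v2) /\
    N%:R * c1 + c2 - (N%:R * c1' + c2') =
      (digit i)%:~R * (v1 + v2) + (digit j)%:~R * (N%:R * (u1 + u2)).

Definition graph_rel K (x y : R) := 0 <= x /\ 0 <= y /\
  forall u1 u2 v1 v2, unit_rel K u1 u2 v1 v2 -> step_rel K u1 u2 v1 v2 x y.

Definition is_max n m (x : R) p q :=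
  win n m x p q /\ forall p' q', win n m x p' q' -> lval p' q' <= lval p q.

Lemma is_max_uniq n m x p q p' q' :
  is_max n m x p q -> is_max n m x p' q' -> lval p q = lval p' q'.
Proof.
by move=> [w h] [w' h']; apply/eqP; rewrite eq_le h' // h.
Qed.

Lemma win_max_relP n m x z1 z2 :
  win_max_rel n%:~R (m%:~R * al) x z1 z2 <->
  exists p q : int, [/\ z1 = p%:~R, z2 = q%:~R * al & is_max n m x p q].
Proof.
have a2E : a.+2%:R = a%:R + 2 :> R by rewrite -natrD addn2.
rewrite /win_max_rel a2E; split.
- move=> [/in_latticeP[p [q [-> ->]]]] [h1 [/smallE h2 h3]].
  exists p, q; split=> //; split=> // p' q' [h4 h5].
  by apply: h3 => //; [apply/in_latticeP; exists p', q'|apply/smallE].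
- move=> [p [q [-> -> [[h1 h2] h3]]]]; split; first by apply/in_latticeP; exists p, q.
  split=> //; split; first exact/smallE.
  by move=> _ _ /in_latticeP[p' [q' [-> ->]]] h4 /smallE h5; apply: h3.
Qed.

(** Multiplication by [al] sends [p + q al] to [N q + p al], which swaps the coordinates, and
    multiplies conjugates by [- al]. *)
Lemma win_max_imgP n m y c1 c2 :
  win_max_img (N%:Z * m)%:~R (n%:~R * al) y c1 c2 <->
  exists p q : int, [/\ c1 = q%:~R, c2 = p%:~R * al & is_max n m (y / al) p q].
Proof.
have a1' := a1; have al' := a_lt; have al_pos : 0 < al by lra.
have a2E : a.+2%:R = a%:R + 2 :> R by rewrite -natrD addn2.
have E2 : n%:~R * al - (N%:Z * m)%:~R = al * lconj n m.
  by rewrite -opprB -/(lconj (N%:Z * m) n) lconjal; ring.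
have vE p q : N%:R * q%:~R + p%:~R * al = al * lval p q.
  by rewrite -lvalal /lval intrM -pmulrn.
have cE p q : N%:R * q%:~R - p%:~R * al = - al * lconj p q.
  by rewrite -lconjal /lconj intrM -pmulrn.
have winE p q : (al * lval p q <= y /\
    small ((a%:R + 2) * (al * lconj n m)) (- al * lconj p q)) <-> win n m (y / al) p q.
  rewrite smallE normrM normrN (gtr0_norm al_pos) mulrCA ler_pM2l //.
  by rewrite /win ler_pdivlMr // mulrC.
rewrite /win_max_img a2E E2; split.
- move=> [/in_latticeP[q [p [-> ->]]]]; rewrite vE cE => -[h1 [h2 h3]].
  exists p, q; split=> //; split; first exact/winE.
  move=> p' q' /winE[h4 h5]; have := h3 q'%:~R (p'%:~R * al).
  by rewrite vE cE ler_pM2l //; apply=> //; apply/in_latticeP; exists q', p'.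
- move=> [p [q [-> -> [/winE[h1 h2] h3]]]]; rewrite vE cE.
  split; first by apply/in_latticeP; exists q, p.
  split=> //; split=> // _ _ /in_latticeP[q' [p' [-> ->]]]; rewrite vE cE ler_pM2l //.
  by move=> h4 h5; apply/h3/winE.
Qed.

(** A nonzero lattice point has a nonzero integer norm, but here
    [z |z'| <= (a + 2) x u' < u u' = 1]. Zero lies in the window, so [z >= 0]. *)
Lemma is_max_eq0 n m x p q : lunit n m -> 0 <= x -> (a%:R + 2) * x < lval n m ->
  is_max n m x p q -> lval p q = 0.
Proof.
move=> u x0 xu [[h1 h2] h3]; have c0 := lunit_conj_gt0 u; have E := lunit_inv u.
have a1' := a1.
have v0 : 0 <= lval p q.
  have := h3 0 0; rewrite /win /lval /lconj !mul0r subr0 addr0 normr0; apply; split=> //.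
  by apply: mulr_ge0; [lra|apply: ltW].
have [|v1] := eqVneq (lval p q) 0; first by [].
have : 1 <= `|lval p q * lconj p q|.
  rewrite /lval /lconj (norm_mulE al2) -intr_norm ler1z.
  suff : p ^+ 2 - N%:Z * q ^+ 2 != 0 by rewrite -normr_gt0; lia.
  apply: contra v1; rewrite subr_eq0 => /eqP/(norm_eq0 Nsq)[-> ->].
  by rewrite /lval mul0r addr0.
rewrite normrM (ger0_norm v0) => v2.
have : lval p q * `|lconj p q| <= x * ((a%:R + 2) * lconj n m) by apply: ler_pM.
have : (a%:R + 2) * x * lconj n m < 1 by rewrite -[ltRHS]E ltr_pM2r.
by lra.
Qed.

(* Telescoping along a chain of units that at least double at every step, up
   to a unit so large that both greatest elements vanish. *)
Lemma graph_rel_is_max K x y n m p q p' q' : (a.+2 <= K)%N -> graph_rel K x y ->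
  lunit n m -> is_max n m x p q -> is_max n m (y / al) p' q' -> lval p' q' = lval p q.
Proof.
move=> aK [x0 [y0 step]].
have a1' := a1; have al' := a_lt; have al_pos : 0 < al by lra.
have y1 : 0 <= y / al by rewrite divr_ge0 // ltW.
pose r := (a%:R + 2) * (x + y / al).
(* Each step at least doubles the unit, so [k] counts the steps left until its value exceeds [r],
   where both maxima are zero. *)
suff H k : forall n m p q p' q', r < (2 ^ k)%:R * lval n m ->
    lunit n m -> is_max n m x p q -> is_max n m (y / al) p' q' -> lval p' q' = lval p q.
  move=> u; have [_ v0] := u; apply: (H (Num.truncn (r / lval n m)).+1) => //.
  rewrite -ltr_pdivrMr //; apply: lt_le_trans (truncnS_gt _) _.
  by rewrite ler_nat ltnW // ltn_expl.
elim: k => [|k IH] {}n {}m {}p {}q {}p' {}q' rk u mx my.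
  rewrite expn0 mul1r in rk.
  have rE : r = (a%:R + 2) * x + (a%:R + 2) * (y / al) by rewrite /r mulrDr.
  have h1 : 0 <= (a%:R + 2) * x by apply: mulr_ge0 => //; lra.
  have h2 : 0 <= (a%:R + 2) * (y / al) by apply: mulr_ge0 => //; lra.
  rewrite (is_max_eq0 u x0 _ mx) ?(is_max_eq0 u y1 _ my) //; lra.
have /step : unit_rel K n%:~R (m%:~R * al) (N%:Z * m)%:~R (n%:~R * al).
  by apply/unit_relP => //; exists n, m.
case=> _ [_ [_ [_ [/unit_relP-/(_ aK)[n1 [m1 [-> -> -> -> u1]]]]]]] [dbl].
case=> z1 [z2 [z3 [z4 [z5 [z6 [z7 [z8 []]]]]]]].
move=> [/win_max_relP[g1 [b1 [-> -> ma]]] /win_max_relP[g2 [b2 [-> -> mb]]]].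
move=> [[/win_max_imgP[c1 [d1 [-> -> mc]]] /win_max_imgP[c2 [d2 [-> -> md]]]]].
move=> [i [j [e1 e2]]].
have vE s t : N%:R * t%:~R + s%:~R * al = al * lval s t.
  by rewrite -lvalal /lval intrM -pmulrn.
rewrite -!/(lval _ _) lvalal in e1; rewrite !vE -!/(lval _ _) lvalal in e2.
rewrite -!/(lval _ _) in dbl.
have k0 : 0 <= (2 ^ k)%:R :> R by rewrite ler0n.
have rk1 : r < (2 ^ k)%:R * lval n1 m1.
  apply: (lt_le_trans rk); rewrite expnS natrM.
  by rewrite -mulrA mulrCA ler_wpM2l.
have Eab := IH _ _ _ _ _ _ rk1 u1 mb md.
rewrite (is_max_uniq mx ma) (is_max_uniq my mc).
apply: (mulfI (lt0r_neq0 al_pos)).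
rewrite Eab -al2 in e2.
have -> : al * lval c1 d1 = al * lval g2 b2 + (al * lval c1 d1 - al * lval g2 b2) by ring.
have -> : lval g1 b1 = lval g2 b2 + (lval g1 b1 - lval g2 b2) by ring.
by rewrite e1 e2; ring.
Qed.

(** Forward, the equal maxima lie within [(a + 2) u] of both [x] and [y / al], and [u] can be
    arbitrarily small. Backward, the next unit is [u] times the fixed one, and the bound on [K]
    makes the digits large enough. *)
Lemma graph_relP K x y p0 q0 : (a.+2 <= K)%N ->
  lunit p0 q0 -> 2 <= lval p0 q0 -> (a%:R + 2) * lval p0 q0 <= K%:R ->
  graph_rel K x y <-> 0 <= x /\ y = al * x.
Proof.
move=> aK e e2 eK.
have a1' := a1; have al' := a_lt; have al_pos : 0 < al by lra.
split.
- move=> G; have [x0 [y0 _]] := G; split=> //.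
  suff E : y / al = x by rewrite -E mulrC divfK // gt_eqF.
  apply/eqP; rewrite -subr_eq0 -normr_le0 leNgt; apply/negP => d0.
  set dl := `|_| in d0; have [n [m [u hu]]] := lunit_large ((a%:R + 2) / dl).
  (* The inverse of a large unit is a small one, here below [dl / (a + 2)]. *)
  have u' := lunitV u; have [p [q [w1 g1 m1]]] := win_max x u'.
  have [p' [q' [w2 g2 m2]]] := win_max (y / al) u'.
  have E := graph_rel_is_max aK G u' (conj w1 m1) (conj w2 m2).
  have [h1 _] := w1; have [h2 _] := w2; rewrite E in g2 h2.
  rewrite lvalN in g1 g2.
  have : dl <= (a%:R + 2) * lconj n m by rewrite /dl ler_norml; apply/andP; split; lra.
  have := lunit_inv u; have := lunit_conj_gt0 u.
  rewrite ltr_pdivrMr // in hu; move=> c0 Eu.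
  apply/negP; rewrite -ltNge -(ltr_pM2l (_ : 0 < lval n m)); last by case: u.
  by rewrite mulrCA Eu mulr1.
- move=> [x0 ->]; split=> //; split; first by apply: mulr_ge0 => //; apply: ltW.
  move=> _ _ _ _ /unit_relP-/(_ aK)[n [m [-> -> -> -> u]]].
  have [_ v0] := u; have c0 := lunit_conj_gt0 u; have E := lunit_inv u.
  have u1 := lunitM u e.
  move: (lvalM n m p0 q0) (lconjM n m p0 q0) u1.
  move: (n * p0 + _) (n * q0 + _) => n1 m1 v1E c1E u1.
  have c1 := lunit_conj_gt0 u1.
  have [p [q [w1 g1 mx1]]] := win_max x u; have [p1 [q1 [w2 g2 mx2]]] := win_max x u1.
  exists n1%:~R, (m1%:~R * al), (N%:Z * m1)%:~R, (n1%:~R * al).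
  split; first by apply/unit_relP => //; exists n1, m1.
  split; first by rewrite -!/(lval _ _) v1E mulrC ler_pM2l.
  exists p%:~R, (q%:~R * al), p1%:~R, (q1%:~R * al).
  exists q%:~R, (p%:~R * al), q1%:~R, (p1%:~R * al).
  split; first by split; apply/win_max_relP; [exists p, q|exists p1, q1].
  have xE : al * x / al = x by rewrite mulrAC divff ?mul1r // gt_eqF.
  split.
    by split; apply/win_max_imgP; rewrite xE; [exists p, q|exists p1, q1].
  (* [F + G al] is the difference of the two maxima divided by [u]; bounds on it and on its
     conjugate yield the digits. *)
  pose F := (p - p1) * n + N%:Z * (q - q1) * - m; pose G := (p - p1) * - m + (q - q1) * n.
  have Fv : lval F G = lval (p - p1) (q - q1) * lconj n m by rewrite -lvalN -lvalM.
  have Fc : lconj F G = lconj (p - p1) (q - q1) * lval n m by rewrite -(lconjN n) -lconjM.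
  have FU : lval p q - lval p1 q1 = lval F G * lval n m.
    by rewrite Fv lvalB -mulrA (mulrC (lconj _ _)) E mulr1.
  have [||FK GK] := @coord_bound K F G.
  + rewrite Fv lvalB normrM (gtr0_norm c0).
    apply: le_trans eK; rewrite -[leRHS]mulr1 -[X in _ <= _ * X]E mulrA ler_pM2r //.
    have [h1 _] := w1; have [h2 _] := w2.
    rewrite v1E in g2.
    have : (a%:R + 2) * lval n m <= (a%:R + 2) * (lval n m * lval p0 q0).
      by rewrite ler_pM2l ?ler_peMr //; lra.
    rewrite -mulrA (mulrC (lval p0 q0)) ler_norml => h3; apply/andP; split; lra.
  + rewrite Fc lconjB normrM (gtr0_norm v0).
    apply: le_trans eK; rewrite -[leRHS]mulr1 -[X in _ <= _ * X]E (mulrC (lval n m)).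
    rewrite mulrA ler_pM2r //.
    have [_ h1] := w1; have [_ h2] := w2.
    apply: le_trans (ler_normB _ _) _; apply: le_trans (lerD h1 h2) _.
    have ec0 := lunit_conj_gt0 e; have eE := lunit_inv e.
    have ec1 : lconj p0 q0 <= 1 by nra.
    rewrite c1E -mulrDr -mulrA ler_pM2l; last lra.
    have : lconj n m * lconj p0 q0 <= lconj n m by rewrite ler_piMr // ltW.
    have : 2 * lconj n m <= lval p0 q0 * lconj n m by rewrite ler_pM2r.
    by lra.
  have [i iE] := digitP FK; have [j jE] := digitP GK.
  exists i, j; rewrite -iE -jE.
  have vE s t : N%:R * t%:~R + s%:~R * al = al * lval s t.
    by rewrite -lvalal /lval intrM -pmulrn.
  rewrite !vE -!/(lval _ _) lvalal -mulrBr FU -al2.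
  by split; rewrite {1}/lval; ring.
Qed.

End Lattice.

(** * First-order definability of the graph relation *)

Section GraphDefinability.
Context {R : realType} {d : rat}.
Local Notation dfn := (@dfn R d).
Variables (b : nat) (al : R).
Hypothesis alE : al = b%:R * Num.sqrt (ratr d).

(** [Z al] is not a predicate of the language, but it is [b] times the predicate for the multiples
    of [sqrt d]. *)
Lemma dfn_in_lattice n i j : (i < n)%N -> (j < n)%N ->
  dfn n (fun e => in_lattice al (e i) (e j)).
Proof.
case: n => // n iN jN; apply: dfn_and; first exact: dfn_inZ.
have dP : dfn n.+1 (fun e => exists x : R,
    (exists c : int, x = c%:~R * Num.sqrt (ratr d)) /\ e j = b%:R * x).
  apply: dfn_ex; apply: dfn_and; first exact: dfn_inZsqrt.
  by apply: dfn_eq; [apply: dterm_var|apply/dtermMn/dterm_var].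
apply: dfn_iff dP => e; rewrite alE; split=> [[_ [[c ->] ->]]|[c ->]].
  by exists c; rewrite mulrCA.
by exists (c%:~R * Num.sqrt (ratr d)); split; [exists c|rewrite mulrCA].
Qed.

Ltac dterm_tac := cbv beta;
  first [ by apply: dterm_var | apply: dterm0
        | apply: dtermD; dterm_tac | apply: dtermN; dterm_tac
        | apply: dtermMn; dterm_tac | apply: dtermMz; dterm_tac ].

Ltac dfn_tac := cbv beta;
  first [ by apply: dfn_in_lattice
        | apply: dfn_and; dfn_tac
        | apply: dfn_exord => ?; dfn_tac
        | apply: dfn_ex; dfn_tac
        | apply: dfn_imp; dfn_tac
        | apply: dfn_all; dfn_tac
        | apply: dfn_lt; dterm_tac
        | apply: dfn_le; dterm_tac
        | apply: dfn_eq; dterm_tac ].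

(** The coefficients permit the substitutions [(x, b y)] and [(- x, - b y)]. *)
Lemma dfn_graph_rel N a K (c c' : int) :
  dfn 2 (fun e => graph_rel N al a K (c%:~R * e 0%N) (c'%:~R * e 1%N)).
Proof.
(* [in_lattice] stays folded so that [dfn_tac] can recognize it. *)
rewrite /graph_rel /step_rel /win_max_rel /win_max_img /unit_rel /slope_box /small.
dfn_tac.
Qed.

End GraphDefinability.

Theorem theoremD (R : realType) (d : rat) (hd : 0 <= d) :
  definable_fun (M := real_two_groups R d)
    (fun x : R => Num.sqrt (ratr d : R) * x).
Proof.
apply: dfn_definable_fun.
pose b := `|denq d|%N; pose N := (`|numq d| * b)%N.
pose al : R := b%:R * Num.sqrt (ratr d).
have b_gt0 : 0 < b%:R :> R by rewrite ltr0n absz_gt0 denq_neq0.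
have al_ge0 : 0 <= al by rewrite mulr_ge0 ?sqrtr_ge0 // ltW.
have al2 : al ^+ 2 = N%:R.
  rewrite exprMn sqr_sqrtr ?ler0q // /ratr natrM /N.
  have -> : (numq d)%:~R = `|numq d|%N%:R :> R.
    by rewrite -[in LHS](gez0_abs (_ : 0 <= numq d)) ?numq_ge0.
  have -> : (denq d)%:~R = b%:R :> R by rewrite -[in LHS](gez0_abs (denq_ge0 d)).
  by field; rewrite gt_eqF.
have graphE x y : y = Num.sqrt (ratr d) * x <-> b%:R * y = al * x.
  rewrite /al -mulrA; split=> [->//|]; apply: mulfI.
  by rewrite gt_eqF.
have [[k NE]|Nsq] := pselect (exists k, N = (k ^ 2)%N).
  (* Here [al] is a natural number and the graph is given by a linear equation. *)
  have alk : al = k%:R.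
    by apply/eqP; rewrite -(@eqrXn2 _ 2) // al2 NE natrX.
  apply: (dfn_iff (P := fun e => b%:R * e 1%N = k%:R * e 0%N)).
    by move=> e; rewrite graphE alk.
  by apply: dfn_eq; apply/dtermMn/dterm_var.
have {}Nsq k : N <> (k ^ 2)%N by move=> NE; apply: Nsq; exists k.
pose a := Num.truncn al.
have /andP[a_le al_lt] := truncn_itv al_ge0; rewrite -/a -natr1 in a_le al_lt.
have a_lt : a%:R < al.
  rewrite lt_neqAle a_le andbT; apply/eqP => aE.
  by apply: (Nsq a); apply/eqP; rewrite -(eqr_nat R) -al2 -aE natrX.
(* Zero is a square, so [N >= 1] and hence [al >= 1]. *)
have a_gt0 : (0 < a)%N.
  rewrite truncn_gt0 -(@ler_pXn2r _ 2) // ?nnegrE // al2 expr1n ler1n lt0n.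
  by apply/eqP => N0; apply: (Nsq 0%N).
have [p [q [u u2]]] := lunit_ge2 al2 Nsq a_gt0 a_lt al_lt.
pose K := maxn a.+2 (Num.truncn ((a%:R + 2) * lval al p q)).+1.
have aK : (a.+2 <= K)%N by rewrite leq_maxl.
have uK : (a%:R + 2) * lval al p q <= K%:R.
  by apply: le_trans (ltW (truncnS_gt _)) _; rewrite ler_nat leq_maxr.
have graphP x y := graph_relP al2 Nsq a_gt0 a_lt al_lt x y aK u u2 uK.
have dG c c' := @dfn_graph_rel R d b al erefl N a K c c'.
(* [graph_rel] covers only [x >= 0]; oddness of the function supplies the other half. *)
apply: dfn_iff (dfn_or (dG 1 b%:Z) (dG (-1) (- b%:Z))) => e.
rewrite !graphP graphE !mulrNz !mulN1r mul1r mulNr mulrN -pmulrn.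
split=> [[[_ //]|[_ /oppr_inj//]]|->].
by have [x0|x0] := leP 0 (e 0%N); [left|right; rewrite oppr_ge0 ltW].
Qed.
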